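(* If $G$ is a simple, connected, undirected, regular, edge-rigid graph with at least one edge, then $G$ is walk-regular, i.e. for every $\ell\ge0$ the number of closed walks of length $\ell$ starting at a vertex $a$ is the same for all vertices $a$.
   Context: Laplacian $L=\sum_{ab\in E}(e_a-e_b)(e_a-e_b)^T$; $\mathcal{L}^*(X)_{ab}=X_{aa}+X_{bb}-2X_{ab}$ for symmetric $X$. With spectral decomposition $L=\sum_{i=1}^r\lambda_iE_i$ (distinct eigenvalues $0=\lambda_1<\dots<\lambda_r$, orthogonal eigenprojectors $E_i$), $G$ is edge-rigid if for each $i\in\{2,\dots,r\}$ there is $\gamma_i>0$ with $\mathcal{L}^*(E_i)=\gamma_i\mathbf{1}$, $\mathbf{1}$ all-ones in $\mathbb{R}^E$. *)

(* Defs.v *)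
From HB Require Import structures.
From mathcomp Require Import all_boot all_order all_algebra.
From mathcomp Require Import reals.

Set Implicit Arguments.
Unset Strict Implicit.
Unset Printing Implicit Defensive.

Import Order.TTheory GRing.Theory Num.Theory.
Local Open Scope ring_scope.

(* Orthogonal projector onto the eigenspace of M for lam: the projector onto
   that space along its orthogonal complement, since the row space of
   kermx U^T is the set of the u such that u *m U^T = 0. *)
Definition eigenproj (R : realType) (n : nat) (M : 'M[R]_n) (lam : R) :
    'M[R]_n :=
  proj_mx (eigenspace M lam) (kermx (eigenspace M lam)^T).

Lemma capmx_orthocompl (R : realType) (n : nat) (U : 'M[R]_n) :
  (U :&: kermx U^T = 0)%MS.
Proof.
apply/eqP/rowV0P => v; rewrite sub_capmx => /andP[/submxP[w vE] /sub_kermxP vU].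
have vv : v *m v^T = 0 by rewrite {2}vE trmx_mul mulmxA vU mul0mx.
apply/rowP => j; rewrite mxE; apply/eqP; rewrite -sqrf_eq0; apply/eqP.
have : \sum_i v 0 i ^+ 2 = 0.
  have := congr1 (fun A : 'M[R]_1 => A 0 0) vv; rewrite !mxE => sum0.
  by rewrite -[RHS]sum0; apply: eq_bigr => i _; rewrite mxE expr2.
by move/psumr_eq0P; apply=> // i _; exact: sqr_ge0.
Qed.

Lemma add_orthocompl (R : realType) (n : nat) (U : 'M[R]_n) :
  row_full (U + kermx U^T)%MS.
Proof.
rewrite /row_full.
have := mxrank_sum_cap U (kermx U^T).
rewrite (capmx_orthocompl U) mxrank0 addn0 mxrank_ker mxrank_tr => ->.
by rewrite subnKC // rank_leq_row.
Qed.

(* [eigenproj M lam] is symmetric, idempotent and has the eigenspace as image;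
   these properties determine it. *)
Lemma eigenprojP (R : realType) (n : nat) (M : 'M[R]_n) (lam : R) :
  [/\ (eigenproj M lam)^T = eigenproj M lam,
      eigenproj M lam *m eigenproj M lam = eigenproj M lam
    & (eigenproj M lam == eigenspace M lam)%MS].
Proof.
rewrite /eigenproj; move: (eigenspace M lam) => U.
have dx := capmx_orthocompl U.
set P := proj_mx _ _.
have PU : (P <= U)%MS by rewrite -[P]mul1mx proj_mx_sub.
have UP : U *m P = U by rewrite /P proj_mx_id.
have PC : (1%:M - P <= kermx U^T)%MS.
  rewrite -[P]mul1mx; apply: proj_mx_compl_sub.
  by rewrite submx_full // add_orthocompl.
have PPT : P *m P^T = P^T.
  have /submxP[w wE] := PU.
  have /sub_kermxP h := PC.
  apply/eqP; rewrite eq_sym -subr_eq0 -{1}[P^T]mul1mx -mulmxBl.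
  by rewrite {2}wE trmx_mul mulmxA h mul0mx.
split.
- by have := congr1 trmx PPT; rewrite trmx_mul !trmxK PPT.
- by rewrite /P proj_mx_proj.
- by rewrite PU -{1}UP submxMl.
Qed.

Section Graph.

(* Adjacency relation of a graph on V.  Matrices over V are indexed through
   [enum_rank : V -> 'I_#|V|]. *)
Variables (R : realType) (V : finType) (e : rel V).

Definition basis_vec (a : V) : 'cV[R]_#|V| := delta_mx (enum_rank a) 0.

(* The comparison of ranks selects each undirected edge exactly once. *)
Definition laplacian : 'M[R]_#|V| :=
  \sum_(a : V) \sum_(b : V | e a b && (enum_rank a < enum_rank b)%N)
    (basis_vec a - basis_vec b) *m (basis_vec a - basis_vec b)^T.

(* The coordinate of L^*(X) at the edge ab; only meaningful when [e a b]. *)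
Definition laplacian_adj (X : 'M[R]_#|V|) (a b : V) : R :=
  X (enum_rank a) (enum_rank a) + X (enum_rank b) (enum_rank b)
  - 2 * X (enum_rank a) (enum_rank b).

(* The Laplacian is positive semidefinite with least eigenvalue 0, so the
   eigenvalues other than the first one are the nonzero ones. *)
Definition edge_rigid : Prop :=
  forall lam : R, eigenvalue laplacian lam -> lam != 0 ->
  exists2 gamma : R, 0 < gamma
    & forall a b : V, e a b ->
        laplacian_adj (eigenproj laplacian lam) a b = gamma.

Definition connected_graph : Prop := forall a b : V, connect e a b.

Definition regular_graph : Prop :=
  exists k : nat, forall a : V, #|[set b | e a b]| = k.

(* A closed walk of length l from a is given by the l vertices following a. *)
Definition closed_walks (l : nat) (a : V) : {set l.-tuple V} :=
  [set w : l.-tuple V | path e a w && (last a w == a)].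

Definition walk_regular : Prop :=
  forall (l : nat) (a b : V), #|closed_walks l a| = #|closed_walks l b|.

End Graph.

(* Main.v *)
(** Let [x_mu] be the diagonal of the eigenprojector [E_mu].  For a [k]-regular
    graph, edge-rigidity makes [x_mu] a constant plus an eigenvector of [L] for
    [2 mu].  As the [E_mu] add up to the identity, the [x_mu] add up to a
    constant, and eigenvectors for different eigenvalues are independent, so
    every [x_mu] is constant.  The number of closed walks of length [l] at [a] is
    the [a]-th diagonal entry of the [l]-th power of the adjacency matrix
    [k - L], that is [\sum_mu (k - mu)^l x_mu(a)]. *)

Require Import Defs.
From mathcomp Require Import all_boot all_order all_algebra.
From mathcomp Require Import complex ring lra.
From mathcomp Require Import reals.

Set Implicit Arguments.
Unset Strict Implicit.
Unset Printing Implicit Defensive.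

Import Order.TTheory GRing.Theory Num.Theory.
Local Open Scope ring_scope.

(** * Spectral decomposition of a real symmetric matrix *)

Section SymmetricSpectrum.

Variables (R : realType) (n : nat) (M : 'M[R]_n).
Hypothesis M_sym : M^T = M.

(** Over the complex numbers the matrix is hermitian, hence unitarily diagonalizable with real
    eigenvalues. Its minimal polynomial therefore splits into distinct real linear factors, and this
    descends to [R]. *)
Lemma sum_eigenspace_sym :
  exists2 rs, uniq rs & (\sum_(r <- rs) eigenspace M r :=: 1%:M)%MS.
Proof.
apply/diagonalizablePeigen.
case: n M M_sym => [|m] A A_sym.
  by rewrite [A](_ : _ = 0) ?thinmx0 //; exact: diagonalizable0.
set f := @real_complex_def R (Phant R).
have real_f x : f x \is Num.real by apply/Creal_ImP; rewrite -complexIm.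
have fM_herm : map_mx f A \is hermsymmx.
  apply: realsym_hermsym.
    by apply/is_hermitianmxP; rewrite expr0 scale1r map_mx_id // map_trmx A_sym.
  by apply/mxOverP => i j; rewrite mxE.
have /orthomx_spectralP fM_eq := hermitian_normalmx fM_herm.
have /mxOverP d_real := hermitian_spectral_diag_real fM_herm.
set d := spectral_diag _ in fM_eq d_real.
have dE i : d 0 i = f (complex.Re (d 0 i)) by exact/esym/RRe_real.
apply/diagonalizableP.
(* Removing repetitions from the spectral diagonal leaves the roots of the minimal polynomial, which
   conjugation does not change. *)
exists (undup [seq complex.Re (d 0 i) | i <- enum 'I_m.+1]); first exact: undup_uniq.
rewrite -(dvdp_map f) -mxminpoly_map fM_eq -conjVmx ?spectral_unit //.
rewrite mxminpoly_uconj ?unitmx_inv ?spectral_unit // mxminpoly_diag.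
rewrite (eq_map dE) (map_comp f) undup_map_inj; last exact: complexI.
have eq_dvd (p q : {poly complex R}) : p = q -> p %| q by move->.
apply: eq_dvd; rewrite big_map rmorph_prod.
by apply: eq_bigr => r _; exact/esym/map_polyXsubC.
Qed.

Lemma mul_eigenproj_id m mu (v : 'M_(m, n)) :
  v *m M = mu *: v -> v *m eigenproj M mu = v.
Proof.
move=> /eigenspaceP vM; apply: proj_mx_id vM; exact: capmx_orthocompl.
Qed.

Lemma eigenproj_mul mu : eigenproj M mu *m M = mu *: eigenproj M mu.
Proof. by case: (eigenprojP M mu) => _ _ /andP[/eigenspaceP]. Qed.

Lemma mul_eigenproj mu : M *m eigenproj M mu = mu *: eigenproj M mu.
Proof.
have [E_sym _ _] := eigenprojP M mu.
by apply: trmx_inj; rewrite trmx_mul linearZ /= M_sym E_sym eigenproj_mul.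
Qed.

(** Evaluating [v *m M *m eigenproj M nu] from either side gives both [mu] and [nu] times
    [v *m eigenproj M nu]. *)
Lemma mul_eigenproj_neq m mu nu (v : 'M_(m, n)) :
  v *m M = mu *: v -> mu != nu -> v *m eigenproj M nu = 0.
Proof.
move=> vM mu_nu; apply/eqP; have: (mu - nu) *: (v *m eigenproj M nu) == 0.
  by rewrite scalerBl scalemxAl -vM -mulmxA mul_eigenproj -scalemxAr subrr.
by rewrite scaler_eq0 subr_eq0 (negPf mu_nu).
Qed.

Lemma sum_eigenproj :
  exists2 rs, uniq rs & \sum_(r <- rs) eigenproj M r = 1%:M.
Proof.
have [rs rs_uniq rs1] := sum_eigenspace_sym; exists rs => //.
rewrite -[LHS]mul1mx.
(* Write the identity as a sum of matrices with rows in the eigenspaces. Each summand is fixed by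
   its own projector and killed by the others. *)
have : (1%:M <= \sum_(r <- rs) eigenspace M r)%MS by rewrite rs1.
rewrite (big_nth 0) big_mkord => /sub_sumsmxP[u ->].
rewrite mulmx_suml; apply: eq_bigr => i _; rewrite mulmx_sumr.
have uM: u i *m eigenspace M rs`_i *m M = rs`_i *: (u i *m eigenspace M rs`_i).
  exact/eigenspaceP/submxMl.
rewrite (bigD1_seq rs`_i) ?mem_nth //= big1 ?addr0 => [|r].
  exact: mul_eigenproj_id.
by rewrite eq_sym; exact: mul_eigenproj_neq.
Qed.

Lemma eigenproj_eq0 mu : ~~ eigenvalue M mu -> eigenproj M mu = 0.
Proof.
move=> /negbNE/eqP E0; apply/eqP; rewrite -submx0 -E0.
by case: (eigenprojP M mu) => _ _ /andP[].
Qed.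

End SymmetricSpectrum.

(** * The Laplacian of a simple graph *)

Section WalkRegular.

Variables (R : realType) (V : finType) (e : rel V).
Hypotheses (e_sym : symmetric e) (e_irr : irreflexive e).

Local Notation N := #|V|.
Local Notation L := (laplacian R e).

Definition adjmx : 'M[R]_N := \matrix_(i, j) (e (enum_val i) (enum_val j))%:R.

(** Passes from edges to ordered adjacent pairs: swapping the two sums turns the terms [G b a] into
    the pairs of decreasing rank, and irreflexivity excludes equal ranks. *)
Lemma sum_edges (G : V -> V -> R) :
  \sum_a \sum_(b | e a b && (enum_rank a < enum_rank b)%N) (G a b + G b a) =
  \sum_a \sum_(b | e a b) G a b.
Proof.
under [RHS]eq_bigr => a _ do
  rewrite (bigID (fun b => enum_rank a < enum_rank b)%N) /=.
under [LHS]eq_bigr => a _ do rewrite big_split.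
rewrite !big_split /=; congr (_ + _).
rewrite (exchange_big_dep xpredT) //=; apply: eq_bigr => a _; apply: eq_bigl => b.
rewrite e_sym -leqNgt ltn_neqAle.
by case: eqVneq => //= /ord_inj/enum_rank_inj ->; rewrite e_irr.
Qed.

Lemma sum_nbr_enum (a : V) (F : V -> R) :
  \sum_(b | e a b) F b = \sum_(j < N) (e a (enum_val j))%:R * F (enum_val j).
Proof.
rewrite big_mkcond (reindex_onto (@enum_val V V) enum_rank) /=; last first.
  by move=> b _; rewrite enum_rankK.
apply: eq_big => [j|j _]; first by rewrite enum_valK eqxx.
by case: (e _ _); rewrite ?mul1r ?mul0r.
Qed.

Lemma laplacianE (i j : 'I_N) :
  L i j = \sum_(b | e (enum_val i) b) ((i == j)%:R - (j == enum_rank b)%:R).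
Proof.
pose d (a : V) (i : 'I_N) : R := (i == enum_rank a)%:R.
(* The entry contributed by an edge, [(d a i - d b i) * (d a j - d b j)], has the form
   [G a b + G b a]. *)
have -> : L i j = \sum_a \sum_(b | e a b) d a i * (d a j - d b j).
  rewrite -sum_edges /laplacian summxE; apply: eq_bigr => a _.
  rewrite summxE; apply: eq_bigr => b _.
  rewrite !mxE big_ord1 !mxE !eqxx !andbT -/(d a i) -/(d b i) -/(d a j) -/(d b j).
  by rewrite mulrBl -[d a j - _ in X in _ - X]opprB mulrN opprK.
rewrite (bigD1 (enum_val i)) //= [X in _ + X]big1 ?addr0 => [|a a_i].
  apply: eq_bigr => b _.
  by rewrite /d enum_valK eqxx mul1r eq_sym.
rewrite big1 // => b _; rewrite /d; case: eqVneq => [ia|]; last by rewrite mul0r.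
by rewrite ia enum_rankK eqxx in a_i.
Qed.

Lemma laplacian_regular k : (forall a, #|[set b | e a b]| = k) ->
  L = k%:R%:M - adjmx.
Proof.
move=> e_reg; apply/matrixP => i j; rewrite laplacianE !mxE sumrB; congr (_ - _).
  by rewrite sumr_const -mulrnA mulnC mulrnA -(e_reg (enum_val i)) cardsE.
rewrite sum_nbr_enum (bigD1 j) //= enum_valK eqxx mulr1 big1 ?addr0 // => j' j'_j.
by rewrite enum_valK eq_sym (negPf j'_j) mulr0.
Qed.

Lemma laplacian_sym : L^T = L.
Proof.
rewrite /laplacian linear_sum; apply: eq_bigr => a _ /=.
by rewrite linear_sum; apply: eq_bigr => b _ /=; rewrite trmx_mul trmxK.
Qed.

Lemma const_mul_laplacian : const_mx 1 *m L = 0 :> 'rV[R]_N.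
Proof.
rewrite /laplacian mulmx_sumr big1 // => a _; rewrite mulmx_sumr big1 // => b _.
rewrite mulmxA [_ *m (_ - _)](_ : _ = 0) ?mul0mx // mulmxBr /basis_vec -!colE.
by apply/matrixP => i j; rewrite !mxE subrr.
Qed.

(** The quadratic form of [L] at [u] is the sum of the squared differences of [u] along the edges.
    If it vanishes, [u] is constant along every path. *)
Lemma laplacian_ker_const (u : 'rV[R]_N) : connected_graph e -> u *m L = 0 ->
  forall i j, u 0 i = u 0 j.
Proof.
move=> e_conn uL.
have quad : \sum_a \sum_(b | e a b && (enum_rank a < enum_rank b)%N)
    (u 0 (enum_rank a) - u 0 (enum_rank b)) ^+ 2 = 0.
  transitivity ((u *m L *m u^T) 0 0); last by rewrite uL mul0mx mxE.
  rewrite /laplacian mulmx_sumr mulmx_suml summxE.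
  apply: eq_bigr => a _; rewrite mulmx_sumr mulmx_suml summxE; apply: eq_bigr => b _.
  rewrite mulmxA -[_ *m _ *m u^T]mulmxA -trmx_mul mxE big_ord1 [_^T _ _]mxE -expr2.
  by rewrite mulmxBr /basis_vec -!colE !mxE.
have u_edge a b : e a b -> u 0 (enum_rank a) = u 0 (enum_rank b).
  wlog ab : a b / (enum_rank a < enum_rank b)%N => [IH eab|eab].
    case: (ltngtP (enum_rank a) (enum_rank b)) => [ab|ba|/ord_inj->//].
      exact: IH.
    by apply/esym/IH => //; rewrite e_sym.
  apply/eqP; rewrite -subr_eq0 -sqrf_eq0; apply/eqP.
  have /psumr_eq0P := quad; move/(_ (fun _ _ => sumr_ge0 _ (fun _ _ => sqr_ge0 _))).
  move=> /(_ a isT)/psumr_eq0P; apply; last by rewrite eab.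
  by move=> *; exact: sqr_ge0.
move=> i j; rewrite -(enum_valK i) -(enum_valK j).
have /connectP[p] := e_conn (enum_val i) (enum_val j).
elim: p (enum_val i) => [a _ -> //|b p IHp a /= /andP[/u_edge -> e_p] last_p].
exact: IHp.
Qed.

(** * Diagonals of the eigenprojectors *)

Definition eproj_diag (mu : R) : 'rV[R]_N := \row_i eigenproj L mu i i.

Lemma eproj_diagE mu i : eproj_diag mu 0 i = eigenproj L mu i i.
Proof. by rewrite [LHS]mxE. Qed.

Hypotheses (e_conn : connected_graph e) (e_rigid : edge_rigid R e).
Variable k : nat.
Hypothesis e_reg : forall a, #|[set b | e a b]| = k.

(** The rows of the projector lie in the kernel of [L], so each is constant; by symmetry all entries
    agree. *)
Lemma eproj_diag0_const i j : eproj_diag 0 0 i = eproj_diag 0 0 j.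
Proof.
have [E_sym _ _] := eigenprojP L 0.
have := eigenproj_mul L 0; rewrite !eproj_diagE.
move: (eigenproj L 0) E_sym => X X_sym XL.
have X_row i' j1 j2 : X i' j1 = X i' j2.
  have := @laplacian_ker_const (row i' X) e_conn.
  by rewrite -row_mul XL scale0r row0 => /(_ erefl j1 j2); rewrite !mxE.
by rewrite (X_row i i j) -[in LHS]X_sym mxE; exact: X_row.
Qed.

(* Averaging L^*(E_mu) = gamma over the neighbours of a vertex turns
   L E_mu = mu E_mu into L x = 2 mu x - k gamma for the diagonal x of E_mu. *)
Lemma eproj_diag_eigen mu : exists c : R,
  (eproj_diag mu - const_mx c) *m L = (2 * mu) *: (eproj_diag mu - const_mx c).
Proof.
have [->|mu_neq0] := eqVneq mu 0.
  case: (posnP N) => [N0|N0].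
    by exists 0; rewrite mulr0 scale0r; apply/rowP => i; have := ltn_ord i; rewrite {2}N0.
  exists (eproj_diag 0 0 (Ordinal N0)).
  rewrite [_ - _](_ : _ = 0) ?mul0mx ?scaler0 //; apply/rowP => i.
  by rewrite [LHS]mxE (eproj_diag0_const i (Ordinal N0)) !mxE subrr.
have [eig|/eigenproj_eq0 E0] := boolP (eigenvalue L mu); last first.
  exists 0; rewrite [_ - _](_ : _ = 0) ?mul0mx ?scaler0 //; apply/rowP => i.
  by rewrite [LHS]mxE eproj_diagE E0 !mxE subrr.
have [gamma _ gammaE] := e_rigid eig mu_neq0.
(* This shift absorbs the term [k gamma], because [L] kills constants. *)
exists (k%:R * gamma / (2 * mu)).
have -> t : const_mx t = t *: const_mx 1 :> 'rV[R]_N.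
  by apply/rowP => i; rewrite !mxE mulr1.
rewrite mulmxBl -scalemxAl const_mul_laplacian scaler0 subr0 scalerBr scalerA.
rewrite mulrCA divff ?mulf_neq0 ?pnatr_eq0 // mulr1.
apply/rowP => i; rewrite (laplacian_regular e_reg).
have := congr1 (fun A : 'M_N => A i i) (eigenproj_mul L mu).
have xE j : eproj_diag mu 0 j = eigenproj L mu j j by exact: eproj_diagE.
rewrite {2}(laplacian_regular e_reg) !mulmxBr !mul_mx_scalar.
move: (eigenproj L mu) (eproj_diag mu) xE gammaE => X x xE gammaE.
rewrite !mxE mulr1.
have deg : \sum_j adjmx j i = k%:R.
  transitivity (\sum_(b | e (enum_val i) b) (1 : R)).
    rewrite sum_nbr_enum; apply: eq_bigr => j _; by rewrite mulr1 mxE e_sym.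
  by rewrite sumr_const -(e_reg (enum_val i)) cardsE.
(* Rigidity reads [2 X i j = x i + x j - gamma] at each neighbour [j] of [i]; sum this over the [k]
   neighbours. *)
have -> : \sum_j X i j * adjmx j i =
    (k%:R * x 0 i + \sum_j x 0 j * adjmx j i - k%:R * gamma) / 2.
  apply: (canRL (mulfK _)); first by rewrite pnatr_eq0.
  rewrite -deg !mulr_suml -big_split -sumrB /=; apply: eq_bigr => j _.
  rewrite !mxE; case eij: (e _ _); last by rewrite !(mulr0, mul0r) addr0 subrr.
  have := gammaE (enum_val i) (enum_val j); rewrite e_sym => /(_ eij) <-.
  rewrite /laplacian_adj !enum_valK !xE; ring.
rewrite -xE; move: (\sum_j _) => s; lra.
Qed.

(** For nonzero [mu], the projector for [2 mu] kills constants and all diagonals for [r != mu]. The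
    diagonals sum to the all-ones vector, so it kills the one for [mu] too; yet it fixes that
    diagonal minus its constant, which is thus zero. *)
Lemma eproj_diag_const rs mu :
  uniq rs -> \sum_(r <- rs) eigenproj L r = 1%:M -> mu \in rs ->
  forall i j, eproj_diag mu 0 i = eproj_diag mu 0 j.
Proof.
move=> rs_uniq rs1 mu_rs.
have [->|mu_neq0] := eqVneq mu 0; first exact: eproj_diag0_const.
have const0 (c : R) : const_mx c *m eigenproj L (2 * mu) = 0 :> 'rV_N.
  apply: (@mul_eigenproj_neq _ _ _ laplacian_sym _ 0).
    rewrite scale0r; have -> : const_mx c = c *: const_mx 1 :> 'rV[R]_N.
      by apply/rowP => i; rewrite !mxE mulr1.
    by rewrite -scalemxAl const_mul_laplacian scaler0.
  by rewrite eq_sym mulf_neq0 ?pnatr_eq0.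
have diag0 r : r != mu -> eproj_diag r *m eigenproj L (2 * mu) = 0.
  move=> r_mu; have [c y_eig] := eproj_diag_eigen r.
  rewrite -[eproj_diag r](subrK (const_mx c)) mulmxDl const0 addr0.
  apply: (mul_eigenproj_neq laplacian_sym y_eig).
  by rewrite (inj_eq (mulfI _)) ?pnatr_eq0.
have diag_mu : eproj_diag mu *m eigenproj L (2 * mu) = 0.
  rewrite -(const0 1) [const_mx 1](_ : _ = \sum_(r <- rs) eproj_diag r).
    rewrite (bigD1_seq mu) //= mulmxDl mulmx_suml big1 ?addr0 // => r; exact: diag0.
  apply/rowP => i; rewrite summxE.
  have := congr1 (fun A : 'M_N => A i i) rs1; rewrite summxE => sum1.
  rewrite [LHS]mxE; under eq_bigr => r _ do rewrite eproj_diagE.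
  by rewrite sum1 mxE eqxx.
have [c y_eig] := eproj_diag_eigen mu.
have := mul_eigenproj_id y_eig; rewrite mulmxBl diag_mu const0 subrr => y0 i j.
move/esym/eqP: y0; rewrite subr_eq0 => /eqP ->.
by rewrite !mxE.
Qed.

(** * Counting walks by powers of the adjacency matrix *)

Definition walkmx l : 'M[R]_N := \matrix_(i, j)
  #|[set w : l.-tuple V | path e (enum_val i) w
                           && (last (enum_val i) w == enum_val j)]|%:R.

Lemma walkmx0 : walkmx 0 = 1%:M.
Proof.
apply/matrixP => i j; rewrite !mxE.
have -> : [set w : 0.-tuple V | path e (enum_val i) w
    && (last (enum_val i) w == enum_val j)] = if i == j then setT else set0.
  apply/setP => w; rewrite inE tuple0 /= (inj_eq enum_val_inj).
  by case: ifP; rewrite inE.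
by case: ifP; rewrite ?cardsT ?card_tuple ?expn0 ?cards0.
Qed.

(** Split a walk at its first step. The remainder need not be closed, which is why [walkmx] allows
    arbitrary endpoints. *)
Lemma walkmxS l : walkmx l.+1 = adjmx *m walkmx l.
Proof.
apply/matrixP => i j; rewrite !mxE.
under eq_bigr => m _ do rewrite !mxE -natrM.
rewrite -natr_sum; congr _%:R.
(* [f] and [g] are the inverse bijections between walks and pairs of a first step and a
   remainder. *)
pose f (w : l.+1.-tuple V) := (thead w, [tuple of behead w]).
pose g (p : V * l.-tuple V) := [tuple of p.1 :: p.2].
rewrite -sum1dep_card (reindex g) /=; last first.
  exists f => [[a w] _|w _]; first by congr pair; apply: val_inj.
  by rewrite /g /f /= -tuple_eta.
rewrite -(pair_big_dep xpredT (fun a (w : l.-tuple V) =>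
  (e (enum_val i) a && path e a w) && (last a w == enum_val j)) (fun _ _ => 1%N)) /=.
rewrite (reindex_onto (@enum_val V V) enum_rank) /=; last first.
  by move=> b _; rewrite enum_rankK.
apply: eq_big => [m|m _]; first by rewrite enum_valK eqxx.
case: (e _ _) => /=; last by rewrite big_pred0_eq mul0n.
by rewrite mul1n sum1dep_card.
Qed.

(** Each factor [adjmx], being [k - L], scales the projector for [r] by [k - r]. *)
Lemma walkmx_spectral rs l : \sum_(r <- rs) eigenproj L r = 1%:M ->
  walkmx l = \sum_(r <- rs) (k%:R - r) ^+ l *: eigenproj L r.
Proof.
move=> rs1; elim: l => [|l IHl].
  by rewrite walkmx0 -rs1; apply: eq_bigr => r _; rewrite expr0 scale1r.
rewrite walkmxS IHl mulmx_sumr; apply: eq_bigr => r _.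
have -> : adjmx = k%:R%:M - L by rewrite (laplacian_regular e_reg) opprB addrC subrK.
rewrite -scalemxAr mulmxBl mul_scalar_mx mul_eigenproj; last exact: laplacian_sym.
by rewrite -scalerBl scalerA -exprSr.
Qed.

End WalkRegular.

Theorem mainTheorem11 (R : realType) (V : finType) (e : rel V)
    (e_sym : symmetric e) (e_irr : irreflexive e)
    (e_conn : connected_graph e) (e_reg : regular_graph e)
    (e_rigid : edge_rigid R e) (e_edge : exists a b : V, e a b) :
  walk_regular e.
Proof.
move=> l a b; case: e_reg => k e_k.
have [rs rs_uniq rs1] := sum_eigenproj (laplacian_sym R e).
have walkE c : #|closed_walks e l c|%:R = walkmx R e l (enum_rank c) (enum_rank c).
  by rewrite mxE enum_rankK.
apply/eqP; rewrite -(eqr_nat R) !walkE (walkmx_spectral e_sym e_irr e_k l rs1).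
(* The two sums agree term by term; [big_seq] keeps the membership in [rs] that [eproj_diag_const]
   requires. *)
rewrite !summxE big_seq [X in _ == X]big_seq; apply/eqP; apply: eq_bigr => r r_rs.
have := eproj_diag_const e_sym e_irr e_conn e_rigid e_k rs_uniq rs1 r_rs.
by move/(_ (enum_rank a) (enum_rank b)); rewrite !mxE => ->.
Qed.
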